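(* Let $\Phi:\mathbb{S}^1\to\mathbb{S}^1$ be a $C^2$ expanding map, i.e. $|\Phi'|>1$, and let $\rho\lambda$ be its unique absolutely continuous invariant probability measure. Let $\tilde{\mathscr{L}}$, $R_g$ and $\mathscr{L}$ be defined by $$\tilde{\mathscr{L}}v(x)=\sum_{y\in\Phi^{-1}(x)}\frac{\rho(y)}{\rho(x)}v(y),\qquad R_g=\lim_{n\to\infty}\big(\sup\tilde{\mathscr{L}}^n1\big)^{1/n},$$ $$\mathscr{L}v(x)=\tilde{\mathscr{L}}v(x)-\frac{\int v\,\Phi'\,\frac{\rho}{\rho\circ\Phi}}{\rho(x)\int1/\rho}\qquad(v\in L^2_0(\rho\lambda)),$$ where integrals are with respect to $\lambda$. Then $R_g\geqslant\min\Phi'>1$, and therefore there is an infinite linearly independent family $(v_i)_i$ of continuous functions in $L^2_0(\rho\lambda)$ such that $\mathscr{L}v_i=v_i$ for all $i$.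
   Context: $\mathbb{S}^1=\mathbb{R}/\mathbb{Z}$ and $\lambda$ is the Lebesgue probability measure. A $C^2$ expanding map of $\mathbb{S}^1$ is a self-covering and has a unique absolutely continuous invariant probability measure $\rho\lambda$, whose density $\rho$ is positive and $C^1$ (known facts). $L^2_0(\rho\lambda)=\{v\in L^2(\rho\lambda):\int v\,d\lambda=0\}$ (real-valued functions of mean zero with respect to $\lambda$). The operator $\tilde{\mathscr{L}}$ is the weighted transfer operator of $\Phi$ with weight $g=\rho/(\rho\circ\Phi)$. The formula for $\mathscr{L}$ is the expression given in the same work for the G\^ateaux derivative at $\rho\lambda$, with respect to the quadratic Wasserstein metric, of the push-forward map $\Phi_\#$ on Borel probability measures of $\mathbb{S}^1$.
   Formalization: The claim $R_g\geqslant\min\Phi'>1$ is stated with $\min|\Phi'|$ in place of $\min\Phi'$, since for orientation-reversing maps such as $\Phi(x)=-2x$ one has $\min\Phi'<-1$; the two agree when $\Phi'>0$. *)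

(* Defs.v *)
From HB Require Import structures.
From mathcomp Require Import all_boot all_order all_algebra.
From mathcomp Require Import all_classical all_reals all_analysis measurable_realfun.

Set Implicit Arguments.
Unset Strict Implicit.
Unset Printing Implicit Defensive.

Import Order.TTheory GRing.Theory Num.Theory.
Import numFieldNormedType.Exports.

Local Open Scope classical_set_scope.
Local Open Scope ring_scope.

Section Circle.
Context {R : realType}.

Definition eqmod1 (x y : R) : bool := x - y \is a Num.int.

Lemma eqmod1_equiv : equiv_class_of eqmod1.
Proof.
split=> [x|x y|y x z]; rewrite /eqmod1.
- by rewrite subrr int_num0.
- by rewrite -opprB rpredN.
- by move=> xy yz; rewrite -(subrKA y) rpredD.
Qed.

Canonical eqmod1_equivRel := EquivRelPack eqmod1_equiv.

End Circle.

(* R/Z with the quotient topology. *)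
Definition circle (R : realType) : Type :=
  quotient_topology {eq_quot (@eqmod1 R)}%qT.

HB.instance Definition _ (R : realType) := PointedTopological.on (circle R).
HB.instance Definition _ (R : realType) := Quotient.on (circle R).

Definition circle_pi {R : realType} : R -> circle R := \pi_(circle R)%qT.

Definition circle_display : measure_display.
Proof. exact: default_measure_display. Qed.

Section Borel.
Context {R : realType}.

Definition circle_borel : set (set (circle R)) := <<s [set U | open U] >>.

Let borel0 : circle_borel set0.
Proof. exact: sigma_algebra0. Qed.

Let borelC A : circle_borel A -> circle_borel (~` A).
Proof. by move=> mA; rewrite -setTD; exact: sigma_algebraCD. Qed.

Let borel_bigcup (F : (set (circle R))^nat) :
  (forall i, circle_borel (F i)) -> circle_borel (\bigcup_i F i).
Proof. exact: sigma_algebra_bigcup. Qed.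

HB.instance Definition _ := @isMeasurable.Build circle_display (circle R)
  circle_borel borel0 borelC borel_bigcup.

Lemma measurable_circle_pi :
  measurable_fun [set: measurableTypeR R]
    (circle_pi : measurableTypeR R -> circle R).
Proof.
apply: (@measurability _ _ _ _ _ _ [set U : set (circle R) | open U]) => //.
move=> _ [U oU <-]; rewrite setTI.
by apply: open_measurable;
  move/continuousP: (@pi_continuous R {eq_quot (@eqmod1 R)}%qT); exact.
Qed.

HB.instance Definition _ := isMeasurableFun.Build _ _ _ _
  (circle_pi : measurableTypeR R -> circle R) measurable_circle_pi.

(* Lebesgue probability measure on R/Z: the image of the uniform probability
   on [0, 1]. *)
Definition lambda : probability (circle R) R :=
  distribution (uniform_prob (@ltr01 R))
    (circle_pi : measurableTypeR R -> circle R).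

End Borel.

Definition class_C {R : realType} (k : nat) (f : R -> R) : Prop :=
  (forall i t, (i < k)%N -> derivable (derive1n i f) t 1) /\ continuous (derive1n k f).

Section CircleMaps.
Context {R : realType}.

Definition is_lift (Phi : circle R -> circle R) (F : R -> R) : Prop :=
  continuous F /\ forall t, Phi (circle_pi t) = circle_pi (F t).

Definition circle_map_C (k : nat) (Phi : circle R -> circle R) : Prop :=
  exists F, is_lift Phi F /\ class_C k F.

Definition circle_fun_C (k : nat) (f : circle R -> R) : Prop :=
  class_C k (f \o circle_pi).

(* Two continuous lifts of Phi differ by an integer constant, and
   F (t + 1) - F t is an integer constant for any such lift F: the value does
   not depend on the chosen lift, nor on the chosen representative of x. *)
Definition circle_deriv (Phi : circle R -> circle R) (x : circle R) : R :=
  derive1 (get (is_lift Phi)) (repr x).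

Definition expanding (Phi : circle R -> circle R) : Prop :=
  circle_map_C 2 Phi /\ forall x, 1 < `|circle_deriv Phi x|.

Definition invariant_measure (Phi : circle R -> circle R)
    (mu : probability (circle R) R) : Prop :=
  forall A, measurable A -> mu (Phi @^-1` A) = mu A.

Definition has_density (mu : probability (circle R) R)
    (rho : circle R -> R) : Prop :=
  forall A, measurable A -> mu A = (\int[lambda]_(x in A) (rho x)%:E)%E.

(* The sum ranges over the points of a fiber of Phi, which is finite when Phi
   is expanding. *)
Definition Ltilde (Phi : circle R -> circle R) (rho v : circle R -> R)
    (x : circle R) : R :=
  \sum_(y \in Phi @^-1` [set x]) rho y / rho x * v y.

Definition Rg_seq (Phi : circle R -> circle R) (rho : circle R -> R)
    (n : nat) : R :=
  sup (range (iter n (Ltilde Phi rho) (cst 1))) `^ n%:R^-1.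

Definition Rg (Phi : circle R -> circle R) (rho : circle R -> R) : R :=
  limn (Rg_seq Phi rho).

Definition Lop (Phi : circle R -> circle R) (rho v : circle R -> R)
    (x : circle R) : R :=
  Ltilde Phi rho v x -
  (\int[lambda]_y (v y * circle_deriv Phi y * (rho y / rho (Phi y)))) /
  (rho x * \int[lambda]_y (rho y)^-1).

(* Mean zero is with respect to lambda, square integrability with respect to
   mu. *)
Definition L2_0 (mu : probability (circle R) R) : set (circle R -> R) :=
  [set v | v \in Lfun mu 2%:E /\ \int[lambda]_x v x = 0].

(* Linear independence in L^2(mu), i.e. modulo equality mu-almost everywhere. *)
Definition lin_indep_ae (mu : probability (circle R) R)
    (v : nat -> circle R -> R) : Prop :=
  forall n (c : 'I_n -> R),
    {ae mu, forall x, \sum_(i < n) c i * v i x = 0} -> forall i, c i = 0.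

End CircleMaps.

Definition is_min {R : realType} (A : set R) (m : R) : Prop :=
  A m /\ lbound A m.

(* Main.v *)
(* Write [T w x] for the sum of [w] over the fiber of [x], so that
   [rho * Ltilde v = T (rho * v)], and let [D >= 2] be the absolute value of
   the degree of [Phi]. As [Phi] is [D]-to-one, [Ltilde^n 1 = T^n rho / rho]
   lies between two positive multiples of [D^n], hence [Rg = D]; and [D] is a
   value of [|Phi'|] by the mean value theorem applied to a lift.

   If [T u = 0], the series [w = \sum_n D^-n * u \o Phi^n] converges uniformly
   and satisfies [w = u + D^-1 * w \o Phi], whence [T w = w] and [u] can be
   recovered from [w]. If in addition [v = w / rho] has mean zero, a change of
   variables shows that the correction term of [Lop v] vanishes, so that
   [Lop v = v]. Infinitely many independent such [u] come from bump functions,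
   and mean zero is obtained by combining the [w]'s in pairs. *)
Require Import Defs.
From mathcomp Require Import all_boot all_order all_algebra.
From mathcomp Require Import all_classical all_reals all_analysis.
From mathcomp Require Import measurable_realfun zify ring lra.
Import Order.TTheory GRing.Theory Num.Theory.
Import numFieldNormedType.Exports.
Local Open Scope classical_set_scope.
Local Open Scope ring_scope.

Set Implicit Arguments.
Unset Strict Implicit.
Unset Printing Implicit Defensive.

(** * Representatives, continuity and compactness on the circle *)

Lemma circle_piK (R : realType) (x : circle R) : circle_pi (repr x) = x.
Proof. exact: reprK. Qed.

Lemma circle_piP (R : realType) (s t : R) :
  circle_pi s = circle_pi t <-> s - t \is a Num.int.
Proof.
split=> [/(@eqquotP R (eqmod1_equivRel : equiv_rel R) (circle R))|st].
  by rewrite /= /eqmod1.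
by apply/(@eqquotP R (eqmod1_equivRel : equiv_rel R) (circle R)).
Qed.

Lemma circle_piDn (R : realType) (t : R) (n : nat) :
  circle_pi (t + n%:R) = circle_pi t.
Proof. by apply/circle_piP; rewrite addrC addKr natr_int. Qed.

Lemma circle_pi_unit (R : realType) (x : circle R) :
  exists2 t, 0 <= t < 1 & circle_pi t = x.
Proof.
exists (repr x - (Num.floor (repr x))%:~R).
  rewrite subr_ge0 ltrBlDl; have := floor_itv (repr x).
  by rewrite intrD.
rewrite -[RHS]circle_piK; apply/circle_piP.
by rewrite addrAC subrr sub0r rpredN intr_int.
Qed.

Lemma continuous_circle (R : realType) (Z : topologicalType)
    (f : circle R -> Z) :
  continuous f <-> continuous (f \o circle_pi).
Proof. exact: quotient_continuous. Qed.

Lemma circle_pi_continuous (R : realType) : continuous (@circle_pi R).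
Proof. exact: pi_continuous. Qed.

(** Lets functions of period 1 descend to the circle through [repr]: [repr (circle_pi t)] and [t]
    differ by an integer. *)
Lemma circle_lift_periodic (R : realType) (T : Type) (g : R -> T) :
  (forall t, g (t + 1) = g t) -> forall t, g (repr (circle_pi t)) = g t.
Proof.
move=> g1 t.
have gn (s : R) (n : nat) : g (s + n%:R) = g s.
  by elim: n => [|n IH]; rewrite ?addr0// -natr1 addrA g1.
have /circle_piP/intrP[n] := circle_piK (circle_pi t).
case: n => n e; first by rewrite -(subrK t (repr _)) e addrC gn.
by rewrite -(gn _ n.+1); congr g; move: e; rewrite NegzE mulrNz; lra.
Qed.

Lemma circle_EVT_max (R : realType) (f : circle R -> R) :
  continuous f -> exists x, forall y, f y <= f x.
Proof.
move/continuous_circle => cf.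
have [c _ fc] := @EVT_max _ _ 0 1 ler01 (continuous_subspaceT cf).
exists (circle_pi c) => y; have [t /andP[t0 t1] <-] := circle_pi_unit y.
by apply: fc; rewrite in_itv /= t0 ltW.
Qed.

Lemma circle_EVT_min (R : realType) (f : circle R -> R) :
  continuous f -> exists x, forall y, f x <= f y.
Proof.
move=> cf; have [|x xP] := @circle_EVT_max R (\- f).
  by move=> x; exact: (cvgN (cf x)).
by exists x => y; rewrite -lerN2; exact: xP.
Qed.

Lemma circle_bounded (R : realType) (f : circle R -> R) :
  continuous f -> exists M : R, forall y, `|f y| <= M.
Proof.
move=> cf; have [|x xP] := @circle_EVT_max R (fun x => `|f x|).
  by move=> x; exact: (cvg_norm (cf x)).
by exists `|f x|.
Qed.

(** * Measurability and integration on the circle *)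

Lemma open_circle_measurable (R : realType) (U : set (circle R)) :
  open U -> measurable U.
Proof. by move=> oU; exact: sub_sigma_algebra. Qed.

Lemma continuous_circle_measurable (R : realType) (f : circle R -> R) :
  continuous f -> measurable_fun setT f.
Proof.
move=> /continuousP cf; apply: (measurability _ (RGenOpens.measurableE R)) => //.
move=> _ [_ [a [b ->] <-]]; rewrite setTI; apply: open_circle_measurable.
by apply: cf; exact: interval_open.
Qed.

Lemma continuous_circle_integrable (R : realType)
    (mu : probability (circle R) R) (f : circle R -> R) :
  continuous f -> mu.-integrable setT (EFin \o f).
Proof.
move=> cf; apply: measurable_bounded_integrable => //.
- exact: le_lt_trans (probability_le1 mu measurableT) (ltry 1).
- exact: continuous_circle_measurable.
have [M fM] := @circle_bounded R f cf.
by exists M; split=> [|N MN x _ /=]; rewrite ?num_real// (le_trans (fM x))// ltW.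
Qed.

Lemma continuous_circle_Lfun2 (R : realType)
    (mu : probability (circle R) R) (f : circle R -> R) :
  continuous f -> f \in Lfun mu 2%:E.
Proof.
move=> cf; apply/andP; split; rewrite inE /=.
  exact: continuous_circle_measurable.
rewrite /finite_norm unlock poweR_lty//.
under eq_integral => x _ do rewrite /= powR_mulrn// -normrX ger0_norm ?sqr_ge0//.
apply: integrable_lty => //.
apply: (@continuous_circle_integrable _ mu (fun x => f x ^+ 2)) => x.
exact: (cvgM (cf x) (cf x)).
Qed.

Lemma integral_lambda (R : realType) (f : circle R -> R) (F : R -> R) :
  (forall t : R, is_derive t 1 F (f (circle_pi t))) -> continuous f ->
  \int[lambda]_x f x = F 1 - F 0.
Proof.
(* The formula for image measures is applied to nonnegative integrands; the general case follows by
   adding a bound [M] to [f]. *)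
have nonneg (g : circle R -> R) (G : R -> R) :
    (forall t : R, is_derive t 1 G (g (circle_pi t))) -> continuous g ->
    (forall x, 0 <= g x) -> \int[lambda]_x g x = G 1 - G 0.
  move=> dG cg g0.
  have cgpi : continuous (g \o circle_pi) by exact/continuous_circle.
  have cG : continuous G.
    by move=> t; apply/differentiable_continuous/derivable1_diffP; have [] := dG t.
  rewrite /Rintegral ge0_integral_distribution//=; last first.
    by apply/measurable_EFinP; exact: continuous_circle_measurable.
  rewrite integral_uniform//=; last 2 first.
  - by apply/measurable_EFinP; exact: (continuous_measurable_fun cgpi).
  - by move=> x; rewrite lee_fin.
  rewrite subr0 invr1 mul1e (@continuous_FTC2 _ (g \o circle_pi) G)//.
  - exact: continuous_subspaceT.
  - split; first by move=> x _; have [] := dG x.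
    + by apply: cvg_at_right_filter; exact: cG.
    + by apply: cvg_at_left_filter; exact: cG.
  - by move=> x _; rewrite derive1E; apply: derive_val.
move=> dF cf; have [M fM] := @circle_bounded R f cf.
have fint : lambda.-integrable setT (EFin \o f).
  exact: continuous_circle_integrable.
have := nonneg (fun x => f x + M) (F + (fun t => M * t)).
rewrite RintegralD//; last by exact: finite_measure_integrable_cst.
rewrite Rintegral_cst//= probability_setT mulr1.
move=> H; apply: (addIr M); transitivity ((F + *%R M) 1 - (F + *%R M) 0).
  apply: H => [t|x|x].
  - apply: is_deriveD.
    by apply: is_derive_eq; rewrite /= ?scaler0 ?addr0 ?add0r /GRing.scale /= mulr1.
  - exact: (cvgD (cf x) (cvg_cst M)).
  - by rewrite -lerBlDr sub0r; have := fM x; rewrite ler_norml => /andP[].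
by rewrite addrfctE mulr1 mulr0 addr0 addrAC.
Qed.

Lemma lambda_open_gt0 (R : realType) (U : set (circle R)) :
  open U -> U !=set0 -> (0 < lambda U)%E.
Proof.
move=> oU [x Ux]; have [t /andP[t0 t1] tx] := circle_pi_unit x.
have : nbhs t (circle_pi @^-1` U).
  apply: open_nbhs_nbhs; split; last by rewrite /= tx.
  by move/continuousP: (@circle_pi_continuous R); exact.
case/nbhs_ballP => r /= r0 rU.
(* Capping at 1 keeps []t, b[] inside [0, 1], where the uniform density is 1. *)
pose b := Num.min 1 (t + r).
have tb : t < b by rewrite lt_min t1 ltrDl r0.
have b1 : b <= 1 by rewrite ge_min lexx.
have btr : b <= t + r by rewrite ge_min lexx orbT.
have tbU : `]t, b[ `<=` circle_pi @^-1` U.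
  move=> s; rewrite /= in_itv /= => /andP[ts sb]; apply: rU.
  rewrite -ball_normE /= distrC ger0_norm ?subr_ge0 ?ltW// ltrBlDl.
  exact: lt_le_trans btr.
apply: (@lt_le_trans _ _ (uniform_prob (@ltr01 R) `]t, b[)); last first.
  apply: le_measure => //; rewrite inE.
  - exact: measurable_itv.
  - rewrite -[X in measurable X]setTI.
    by apply: measurable_circle_pi => //; exact: open_circle_measurable.
rewrite /uniform_prob (eq_integral (cst 1%E)).
  rewrite integral_cst//= mul1e lebesgue_measure_itv /= lte_fin tb.
  by rewrite -EFinB lte_fin subr_gt0.
move=> s; rewrite inE /= in_itv /= => /andP[ts sb].
rewrite /uniform_pdf subr0 invr1 ifT//.
by rewrite (le_trans t0 (ltW ts)) (le_trans (ltW sb) b1).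
Qed.

(** The set where [f] is nonzero is open, and a nonempty open set has positive [mu]-measure because
    [rho] is bounded below by its positive minimum. *)
Lemma continuous_ae_eq0 (R : realType) (mu : probability (circle R) R)
    (rho f : circle R -> R) :
  has_density mu rho -> continuous rho -> (forall x, 0 < rho x) ->
  continuous f -> {ae mu, forall x, f x = 0} -> forall x, f x = 0.
Proof.
move=> mu_rho crho rho_gt0 cf f0.
pose U := [set x | f x != 0].
have oU : open U.
  by move/continuousP : cf => /(_ [set y | y != 0]); apply; exact: open_neq.
have mU : measurable U by exact: open_circle_measurable.
have muU : mu U = 0%E.
  apply: measure_negligible => //; apply: negligibleS f0 => x /= /eqP; exact.
have [y0 rho_min] := circle_EVT_min crho.
suff U0 : ~ (U !=set0) by move=> x; apply: contrapT => /eqP fx; apply: U0; exists x.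
move=> /(lambda_open_gt0 oU); apply/negP; rewrite -leNgt.
rewrite -(@pmule_rle0 _ (rho y0)%:E) ?lte_fin//.
rewrite -muU mu_rho// -integral_cst//; apply: ge0_le_integral => //.
- by move=> x _; rewrite /= lee_fin ltW.
- by apply/measurable_EFinP/measurable_funTS; exact: continuous_circle_measurable.
- by move=> x _ /=; rewrite lee_fin.
Qed.

(** * Lifts of circle maps *)

Lemma continuous_int_constant (R : realType) (g : R -> R) :
  continuous g -> (forall t, g t \is a Num.int) -> forall s t, g s = g t.
Proof.
move=> cg gint s t; wlog st : s t / s <= t.
  by move=> H; case: (leP s t) => [/H//|/ltW/H/esym].
apply: contrapT => /eqP gst.
have [m gs] := intrP (gint s); have [n gt] := intrP (gint t).
(* An integer plus one half, which the intermediate value theorem would force [g] to attain. *)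
pose v := Num.min (g s) (g t) + 2^-1.
have [|c _ gc] := @IVT _ g s t v st (continuous_subspaceT cg).
  rewrite lerDl invr_ge0 ler0n /= /v.
  rewrite gs gt (inj_eq intr_inj) in gst *.
  have -> : Order.min (m%:~R : R) n%:~R = (Order.min m n)%:~R.
    by rewrite /Order.min ltr_int; case: ifP.
  have -> : Order.max (m%:~R : R) n%:~R = (Order.max m n)%:~R.
    by rewrite /Order.max ltr_int; case: ifP.
  apply: (@le_trans _ _ (Order.min m n + 1)%:~R).
    by rewrite intrD lerD2l invf_le1 ?ltr0n ?ler1n.
  by rewrite ler_int; lia.
have : v - Num.min (g s) (g t) \is a Num.int.
  by apply: rpredB; [rewrite -gc|rewrite /Num.min; case: ifP].
rewrite /v addrAC subrr add0r => /intrP[k].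
move=> /(congr1 ( *%R 2)); rewrite divff ?pnatr_eq0// -[2]/(2%:~R) -intrM.
by rewrite -[LHS]/(1%:~R) => /intr_inj; lia.
Qed.

Lemma lift_diff_constant (R : realType) (Phi : circle R -> circle R)
    (F1 F2 : R -> R) :
  is_lift Phi F1 -> is_lift Phi F2 -> forall s t, F1 s - F2 s = F1 t - F2 t.
Proof.
move=> [cF1 F1P] [cF2 F2P].
apply: (@continuous_int_constant _ (F1 \- F2)) => [t|t].
  exact: (cvgB (cF1 t) (cF2 t)).
by apply/circle_piP; rewrite -F1P -F2P.
Qed.

Lemma lift_translate (R : realType) (Phi : circle R -> circle R) (F : R -> R)
    (n : int) : is_lift Phi F -> is_lift Phi (fun t => F (t + n%:~R)).
Proof.
move=> [cF FP]; split=> [t|t].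
  apply: continuous_comp; last exact: cF.
  exact: (cvgD cvg_id (cvg_cst _)).
by rewrite -FP; congr Phi; apply/circle_piP; rewrite opprD addNKr rpredN intr_int.
Qed.

Lemma is_derive_translate (R : realType) (F : R -> R) (a b t f : R) :
  is_derive (t + a) 1 F f -> is_derive t 1 (fun x => F (x + a) + b) f.
Proof.
move=> dF; rewrite -[f]addr0; apply: is_deriveD.
rewrite -[f]mulr1; apply: (@is_derive1_comp _ F (fun x => x + a)).
by apply: is_derive_eq; rewrite addr0.
Qed.

(** [circle_deriv] uses a lift picked by [get], a priori only continuous. It differs from a C^2 lift
    by a constant, hence has the same derivative. *)
Lemma expanding_lift (R : realType) (Phi : circle R -> circle R) :
  expanding Phi ->
  exists (F : R -> R) (d : int),
    [/\ forall t : R, is_derive t 1 F (circle_deriv Phi (circle_pi t)),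
        continuous (circle_deriv Phi),
        forall t, Phi (circle_pi t) = circle_pi (F t) &
        forall t, F (t + 1) = F t + d%:~R].
Proof.
move=> [[F1 [F1P [dF1 _]]] _].
pose F : R -> R := get (is_lift Phi).
have FP : is_lift Phi F by apply: getPex; exists F1.
have dF1' (t : R) : is_derive t 1 F1 (F1^`()%classic t).
  by rewrite derive1E; apply/derivableP; exact: (dF1 0%N).
have cF1' : continuous F1^`()%classic.
  by move=> t; apply/differentiable_continuous/derivable1_diffP; exact: (dF1 1%N).
have FF1 : F = fun t => F1 (t + 0) + (F 0 - F1 0).
  apply/funext => t; rewrite addr0 -(lift_diff_constant FP F1P t 0).
  by rewrite addrC subrK.
have dF (t : R) : is_derive t 1 F (F1^`()%classic t).
  by rewrite FF1; apply: is_derive_translate; rewrite addr0.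
have F'E t : F^`()%classic t = F1^`()%classic t by rewrite derive1E derive_val.
(* Translating the argument by an integer gives another lift, which differs from [F] by a
   constant. *)
have F'per s t : s - t \is a Num.int -> F^`()%classic s = F^`()%classic t.
  move=> /intrP[n stn].
  have FnE : F = fun x => F (x + n%:~R) + (F t - F s).
    apply/funext => x.
    have := lift_diff_constant FP (lift_translate n FP) x t.
    by rewrite -stn subrKC; lra.
  rewrite [RHS]derive1E {2}FnE F'E; apply/esym/derive_val.
  by apply: is_derive_translate; rewrite -stn subrKC.
have dE t : circle_deriv Phi (circle_pi t) = F1^`()%classic t.
  rewrite -F'E; apply: (circle_lift_periodic (g := F^`()%classic)) => x.
  by apply: F'per; rewrite addrC addKr rpred1.
have [d Fd] : exists d : int, F 1 - F 0 = d%:~R.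
  apply/intrP/circle_piP; rewrite -!(proj2 FP); congr Phi.
  by apply/circle_piP; rewrite subr0 rpred1.
exists F, d; split.
- by move=> t; rewrite dE.
- apply/continuous_circle => t.
  by rewrite (_ : _ \o _ = F1^`()%classic)//; apply/funext.
- exact: (proj2 FP).
- move=> t; have := lift_diff_constant FP (lift_translate 1 FP) t 0.
  by rewrite add0r -Fd; lra.
Qed.

(** * Growth rate of the iterated transfer operator *)

Lemma cvg_root_geometric (R : realType) (a b D : R) (u : nat -> R) :
  0 < a -> 0 < D -> (forall n, a * D ^+ n <= u n <= b * D ^+ n) ->
  u n `^ n%:R^-1 @[n --> \oo] --> D.
Proof.
move=> a0 D0 uab.
have b0 : 0 < b.
  by have /andP[] := uab 0%N; rewrite !expr0 !mulr1 => au ub; lra.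
have root (c : R) : 0 < c -> (c * D ^+ n.+1) `^ n.+1%:R^-1 @[n --> \oo] --> D.
  move=> c0.
  rewrite (_ : (fun n => _) = fun n => expR (harmonic n * ln c) * D); last first.
    apply/funext => n; rewrite powRM ?exprn_ge0 ?ltW// -powR_mulrn ?ltW//.
    by rewrite -powRrM divff ?pnatr_eq0// powRr1 ?ltW// /powR gt_eqF.
  rewrite -[X in _ --> X]mul1r -expR0 -(mul0r (ln c)).
  apply: cvgMl; apply: (cvg_comp (fun n => harmonic n * ln c) expR).
    by apply: cvgMl; exact: cvg_harmonic.
  exact: continuous_expR.
(* At index 0 the exponent [n%:R^-1] is 0, so the squeeze starts at index 1. *)
rewrite -cvg_shiftS; apply: squeeze_cvgr (root _ a0) (root _ b0).
apply: nearW => n /=; have /andP[au ub] := uab n.+1.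
have u0 : 0 <= u n.+1 by apply: le_trans au; rewrite mulr_ge0 ?exprn_ge0 ?ltW.
by rewrite !ge0_ler_powR ?invr_ge0 ?nnegrE// mulr_ge0 ?exprn_ge0 ?ltW.
Qed.

Section TransferGrowth.
Context {R : realType} {Phi : circle R -> circle R} {rho : circle R -> R} {D : nat}.
Hypothesis rho_gt0 : forall x, 0 < rho x.
Hypothesis rho_continuous : continuous rho.
Hypothesis D_gt0 : (0 < D)%N.
Hypothesis fiber : forall x, exists h : 'I_D -> circle R,
  forall v : circle R -> R, \sum_(y \in Phi @^-1` [set x]) v y = \sum_(j < D) v (h j).

(** At a preimage [y] of [x], the weight [rho y / rho x] cancels the denominator [rho y] of the
    inductive bound, and the [D] preimages supply one more factor [D]. *)
Lemma Ltilde_iter_bounds (A B : R) : (forall x, A <= rho x <= B) ->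
  forall n x, A * D%:R ^+ n / rho x <= iter n (Ltilde Phi rho) (cst 1) x <=
              B * D%:R ^+ n / rho x.
Proof.
move=> AB; elim=> [|n IH] x.
  by rewrite /= expr0 !mulr1 ler_pdivrMr// ler_pdivlMr// !mul1r AB.
rewrite iterS /Ltilde -/(Ltilde Phi rho); have [h ->] := fiber x.
set v := iter n _ _ in IH *.
have ABv j : A * D%:R ^+ n / rho x <= rho (h j) / rho x * v (h j) <=
             B * D%:R ^+ n / rho x.
  have /andP[] := IH (h j); rewrite ler_pdivrMr// ler_pdivlMr// => Av vB.
  by rewrite [rho _ / _ * _]mulrAC [rho _ * _]mulrC !ler_pM2r ?invr_gt0// Av vB.
have card (c : R) : c * D%:R ^+ n.+1 / rho x = \sum_(j < D) c * D%:R ^+ n / rho x.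
  by rewrite sumr_const card_ord -mulr_natr exprSr; ring.
by rewrite !card; apply/andP; split; apply: ler_sum => j _; have /andP[] := ABv j.
Qed.

Lemma Rg_seq_cvg : Rg_seq Phi rho n @[n --> \oo] --> (D%:R : R).
Proof.
have [xA /(_ _)rhoA] := circle_EVT_min rho_continuous.
have [xB /(_ _)rhoB] := circle_EVT_max rho_continuous.
set A := rho xA in rhoA; set B := rho xB in rhoB.
have A0 : 0 < A := rho_gt0 xA; have B0 : 0 < B := rho_gt0 xB.
have D0 n : 0 <= D%:R ^+ n :> R by rewrite exprn_ge0 ?ler0n.
have bnd n x : A / B * D%:R ^+ n <= iter n (Ltilde Phi rho) (cst 1) x <=
               B / A * D%:R ^+ n.
  have /andP[Lx xL] : A * D%:R ^+ n / rho x <= iter n (Ltilde Phi rho) (cst 1) x <=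
              B * D%:R ^+ n / rho x.
    by apply: Ltilde_iter_bounds => y; rewrite rhoA rhoB.
  rewrite [A / B * _]mulrAC [B / A * _]mulrAC.
  apply/andP; split; [apply: le_trans Lx|apply: le_trans xL _];
    by rewrite ler_wpM2l ?lef_pV2 ?posrE// mulr_ge0// ltW.
apply: (@cvg_root_geometric _ (A / B) (B / A)); rewrite ?divr_gt0 ?ltr0n// => n.
(* That a value lies below [sup] requires a set bounded above, so the upper bound serves here
   too. *)
apply/andP; split.
  have /andP[Ax _] := bnd n point; apply: le_trans Ax _.
  apply: ub_le_sup; last by exists point.
  by exists (B / A * D%:R ^+ n) => _ [x _ <-]; have /andP[] := bnd n x.
apply: ge_sup; first by exists (iter n (Ltilde Phi rho) (cst 1) point), point.
by move=> _ [x _ <-]; have /andP[] := bnd n x.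
Qed.

End TransferGrowth.

(** * A cohomological equation solved by a geometric series *)

Section GeometricSeries.
Context {R : realType} {T : topologicalType} {f : T -> T} {u : T -> R} {c M : R}.
Hypothesis f_continuous : continuous f.
Hypothesis u_continuous : continuous u.
Hypothesis u_bounded : forall x, `|u x| <= M.
Hypothesis c_ge0 : 0 <= c.
Hypothesis c_lt1 : c < 1.

Let W (n : nat) (x : T) : R := \sum_(0 <= k < n) c ^+ k * u (iter k f x).

Let W0 : W 0 = cst 0.
Proof. by apply/funext => x; rewrite /W big_nil. Qed.

(** Peeling off the first term rather than the last makes this a finite form of the equation to
    solve. *)
Let W_recl n x : W n.+1 x = u x + c * W n (f x).
Proof.
rewrite /W big_nat_recl//= expr0 mul1r mulr_sumr; congr (_ + _).
by apply: eq_bigr => k _; rewrite -iterS iterSr exprS mulrA.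
Qed.

Let W_continuous n : continuous (W n).
Proof.
elim: n => [|n IH] x; first by rewrite W0; exact: cvg_cst.
rewrite (_ : W n.+1 = fun x => u x + c * W n (f x)); last first.
  by apply/funext => y; exact: W_recl.
apply: cvgD; first exact: u_continuous.
apply: cvgMr; apply: (@continuous_comp _ _ _ f (W n)); last exact: IH.
exact: f_continuous.
Qed.

Let W_cvg x : cvgn (W ^~ x).
Proof.
apply: (@normed_cvg _ R^o (fun k => c ^+ k * u (iter k f x))).
apply: (@series_le_cvg _ _ (geometric M c)) => [n|n|n|].
- exact: normr_ge0.
- by rewrite /geometric /= mulr_ge0 ?exprn_ge0// (le_trans _ (u_bounded x)).
- rewrite /geometric /= normrM ger0_norm ?exprn_ge0// mulrC ler_wpM2r ?exprn_ge0//.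
- by apply: is_cvg_geometric_series; rewrite ger0_norm.
Qed.

Let W_bounded n x : `|W n x| <= M / (1 - c).
Proof.
have c1 : 0 < 1 - c by rewrite subr_gt0.
elim: n x => [|n IH] x.
  rewrite W0 normr0 divr_ge0// ?(ltW c1)//.
  exact: le_trans (u_bounded x).
rewrite W_recl (le_trans (ler_normD _ _))// normrM (ger0_norm c_ge0).
rewrite (le_trans (lerD (u_bounded x) (ler_wpM2l c_ge0 (IH (f x)))))//.
by rewrite le_eqVlt; apply/orP; left; apply/eqP; field; rewrite gt_eqF.
Qed.

(** The limit of [W] satisfies the equation by [W_recl]. Subtracting the two, each step multiplies
    the error by [c], so convergence is uniform and the limit continuous. *)
Lemma geometric_cohomological_equation :
  exists w : T -> R, continuous w /\ forall x, w x = u x + c * w (f x).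
Proof.
pose w x := limn (W ^~ x).
have wE x : w x = u x + c * w (f x).
  have W_shift : W n.+1 x @[n --> \oo] --> w x.
    by rewrite (cvg_shiftS (W ^~ x)); exact: W_cvg.
  apply: cvg_unique W_shift _ => //.
  rewrite (_ : (fun n => W n.+1 x) = fun n => u x + c * W n (f x)); last first.
    by apply/funext => n; exact: W_recl.
  by apply: cvgD; [exact: cvg_cst|apply: cvgMr; exact: W_cvg].
have w_bounded x : `|w x| <= M / (1 - c).
  rewrite -(cvg_lim _ (cvg_norm (@W_cvg x)))//; apply: limr_le.
    by apply: is_cvg_norm; exact: W_cvg.
  by apply: nearW => n; exact: W_bounded.
have wW n x : `|w x - W n x| <= c ^+ n * (M / (1 - c)).
  elim: n x => [|n IH] x; first by rewrite W0 subr0 expr0 mul1r.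
  rewrite wE W_recl opprD addrACA subrr add0r -mulrBr normrM (ger0_norm c_ge0).
  by rewrite exprS -mulrA ler_wpM2l.
exists w; split=> // x; apply/cvgrPdist_le => e e0.
have e3 : 0 < e / 3 by rewrite divr_gt0.
have [n cn] : exists n, c ^+ n * (M / (1 - c)) <= e / 3.
  have : c ^+ n * (M / (1 - c)) @[n --> \oo] --> 0.
    rewrite -(mul0r (M / (1 - c))); apply: cvgMl; apply: cvg_expr.
    by rewrite ger0_norm.
  move=> /cvgr_dist_le /(_ _ e3)[n _ /(_ n (leqnn n))].
  by rewrite sub0r normrN => /(le_trans (ler_norm _)); exists n.
near=> y.
have -> : w x - w y = (w x - W n x) + (W n x - W n y) - (w y - W n y) by ring.
have Wxy : `|W n x - W n y| <= e / 3.
  by near: y; apply: cvgr_dist_le => //; exact: W_continuous.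
have n1 := ler_normB (w x - W n x + (W n x - W n y)) (w y - W n y).
have n2 := ler_normD (w x - W n x) (W n x - W n y).
by have := wW n x; have := wW n y; lra.
Unshelve. all: end_near. Qed.

End GeometricSeries.

(** * Antiderivatives on the real line *)

Lemma continuous_antiderivative (R : realType) (f : R -> R) :
  continuous f -> exists Q : R -> R, forall t : R, is_derive t 1 Q (f t).
Proof.
move=> cf.
have fint (a b : R) : lebesgue_measure.-integrable `[a, b] (EFin \o f).
  apply: continuous_compact_integrable; first exact: segment_compact.
  exact: continuous_subspaceT.
pose I a x := \int[lebesgue_measure]_(t in `[a, x]) f t.
have I_chasles a b x : a <= b -> b <= x -> I a x = I a b + I b x.
  move=> ab bx; apply/eqP; rewrite addrC -subr_eq; apply/eqP.
  rewrite /I Rintegral_itvB// ?bnd_simp//.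
  apply: Rintegral_itv_obnd_cbnd; apply: integrableS (fint b x) => //.
  by apply: subset_itvr; rewrite bnd_simp.
(* This base point lies below both 0 and [x], so [Q x] is the signed integral from 0 to [x]; by [QE]
   any lower base gives the same value. *)
pose base (x : R) : R := - (`|x| + 1).
pose Q (x : R) := I (base x) x - I (base x) 0.
have QE a x : a <= base x -> Q x = I a x - I a 0.
  move=> ax; rewrite (I_chasles _ _ x ax) ?(I_chasles _ _ 0 ax) /Q; last 2 first.
  - by rewrite /base oppr_le0 addr_ge0.
  - by rewrite /base; have := ler_norm (- x); rewrite normrN; lra.
  by rewrite opprD addrACA subrr add0r.
exists Q => t.
(* The base [base t - 1] is valid for all [x] at distance at most 1 from [t], which allows
   differentiating with a fixed lower endpoint. *)
have [dI dIE] : derivable (I (base t - 1)) t 1 /\ (I (base t - 1))^`()%classic t = f t.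
  apply: (@continuous_FTC1_closed _ f (base t - 1) t (t + 1)) => //.
  - by rewrite ltrDl.
  - by rewrite /base; have := ler_norm (- t); rewrite normrN; lra.
  - exact: cf.
apply: (@near_eq_is_derive _ _ _ (fun x => I (base t - 1) x - I (base t - 1) 0)).
  near=> x; apply/esym/QE.
  have : `|t - x| <= 1 by near: x; apply: cvgr_dist_le => //; exact: cvg_id.
  have := ler_distD t x 0; rewrite !subr0 distrC /base; lra.
rewrite -[f t]subr0; apply: is_deriveB.
by rewrite -dIE derive1E; exact/derivableP.
Unshelve. all: end_near. Qed.

(** * Functions with vanishing sums over integer translates *)

(* [bump k] is positive on the open interval (1/(k+2), 1/(k+1)), and 0
   elsewhere. *)
Definition bump (R : realType) (k : nat) (y : R) : R :=
  let z := (y - harmonic k.+1) * (harmonic k - y) in z + `|z|.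

Definition bump_center (R : realType) (k : nat) : R :=
  (harmonic k.+1 + harmonic k) / 2.

Lemma harmonic_decr (R : realType) (j k : nat) :
  (j < k)%N -> harmonic k < harmonic j :> R.
Proof. by move=> jk; rewrite /harmonic /= ltf_pV2 ?posrE ?ltr0n// ltr_nat. Qed.

Lemma bump_center_neq0 (R : realType) (k : nat) :
  bump k (bump_center R k) != 0.
Proof.
rewrite /bump /bump_center.
have := @harmonic_decr R k k.+1 (ltnSn k).
set a := harmonic _; set b := harmonic _ => ab.
have z0 : 0 < ((a + b) / 2 - a) * (b - (a + b) / 2).
  by apply: mulr_gt0; lra.
by rewrite gt_eqF// addr_gt0// normr_gt0 gt_eqF.
Qed.

Lemma bump_center_eq0 (R : realType) (j k : nat) :
  j != k -> bump j (bump_center R k) = 0.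
Proof.
move=> jk; rewrite /bump /bump_center.
have kk := @harmonic_decr R k k.+1 (ltnSn k).
have jj := @harmonic_decr R j j.+1 (ltnSn j).
suff z0 : ((harmonic k.+1 + harmonic k) / 2 - harmonic j.+1) *
    (harmonic j - (harmonic k.+1 + harmonic k) / 2) <= 0 :> R.
  by rewrite ler0_norm// subrr.
have leh (m n : nat) : (m <= n)%N -> harmonic n <= harmonic m :> R.
  by rewrite leq_eqVlt => /predU1P[->//|/(@harmonic_decr R)/ltW].
move: jk; rewrite neq_ltn => /orP[/leh|/leh] jk.
  by apply: mulr_le0_ge0; lra.
by apply: mulr_ge0_le0; lra.
Qed.

Lemma bump_continuous (R : realType) (k : nat) : continuous (@bump R k).
Proof.
have cz : continuous (fun y : R => (y - harmonic k.+1) * (harmonic k - y)).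
  move=> y; apply: cvgM; apply: cvgB; (exact: cvg_cst || exact: cvg_id).
by move=> y; apply: cvgD; [exact: cz|apply: cvg_norm; exact: cz].
Qed.

(* The sine factor, of period [D], has vanishing sums over translates by
   [0, 1, ..., D - 1]; multiplying by functions of period 1 preserves this. *)
Definition sumfree (R : realType) (D k : nat) (s : R) : R :=
  bump k (cos (pi *+ 2 * s)) * sin (pi * (2 * s + 1) / D%:R).

Lemma cos2piDn (R : realType) (s : R) (n : nat) :
  cos (pi *+ 2 * (s + n%:R)) = cos (pi *+ 2 * s).
Proof. by rewrite mulrDr mulr_natr (periodicn (@cosD2pi R)). Qed.

Lemma sumfree_continuous (R : realType) (D k : nat) : continuous (@sumfree R D k).
Proof.
move=> s; apply: cvgM.
  apply: (@continuous_comp _ _ _ (fun s => cos (pi *+ 2 * s)) (bump k)).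
    apply: (@continuous_comp _ _ _ (fun s => pi *+ 2 * s) cos).
      by apply: cvgMr; exact: cvg_id.
    exact: continuous_cos.
  exact: bump_continuous.
apply: (@continuous_comp _ _ _ (fun s : R => pi * (2 * s + 1) / D%:R : R) sin).
  apply: cvgMl; apply: cvgMr; apply: cvgD; last exact: cvg_cst.
  by apply: cvgMr; exact: cvg_id.
exact: continuous_sin.
Qed.

Lemma sumfree_periodic (R : realType) (D k : nat) (s : R) :
  (0 < D)%N -> sumfree D k (s + D%:R) = sumfree D k s.
Proof.
move=> D0; rewrite /sumfree cos2piDn; congr (_ * _).
rewrite -[RHS](sinD2pi); congr sin; rewrite -mulr_natr.
by field; rewrite pnatr_eq0 -lt0n.
Qed.

(** Multiplied by [2 * sin (pi / D)], nonzero as [1 < D], each sine becomes a difference of cosines;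
    the sum then telescopes over a full period. *)
Lemma sum_sumfree (R : realType) (D k : nat) (s : R) :
  (1 < D)%N -> \sum_(j < D) sumfree D k (s + j%:R) = 0.
Proof.
move=> D1; have D0 : (0 < D)%N by exact: ltn_trans D1.
have DR : D%:R != 0 :> R by rewrite pnatr_eq0 -lt0n.
under eq_bigr do rewrite /sumfree cos2piDn.
rewrite -mulr_sumr; apply/eqP; rewrite mulf_eq0; apply/orP; right.
have sinD : 2 * sin (pi / D%:R) != 0 :> R.
  rewrite mulf_neq0 ?pnatr_eq0// gt_eqF// sin_gt0_pi// divr_gt0 ?pi_gt0 ?ltr0n//=.
  by rewrite ltr_pdivrMr ?ltr0n// ltr_pMr ?pi_gt0// ltr1n.
rewrite -(mulrI_eq0 _ (mulfI sinD)) mulr_sumr.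
pose c j := cos (pi *+ 2 * (s + j%:R) / D%:R) : R.
rewrite (eq_bigr (fun j : 'I_D => - (c j.+1 - c j))); last first.
  move=> j _; rewrite /c.
  set a := pi * _ / _.
  have -> : pi *+ 2 * (s + j%:R) / D%:R = a - pi / D%:R by rewrite /a -mulr_natr; field.
  have -> : pi *+ 2 * (s + j.+1%:R) / D%:R = a + pi / D%:R.
    by rewrite /a -mulr_natr -natr1; field.
  by rewrite cosD cosB; ring.
rewrite sumrN oppr_eq0 -(big_mkord xpredT (fun j => c j.+1 - c j)) telescope_sumr//.
rewrite subr_eq0 /c addr0 -[X in _ == X]cosD2pi; apply/eqP; congr cos.
by rewrite -mulr_natr; field.
Qed.

Definition sumfree_point (R : realType) (k : nat) : R :=
  acos (bump_center R k) / (pi *+ 2).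

Lemma bump_center_itv (R : realType) (k : nat) : 0 < bump_center R k < 1.
Proof.
have h0 := @harmonic_gt0 R k.+1; have h1 := @harmonic_decr R k k.+1 (ltnSn k).
have : harmonic k <= 1 :> R by rewrite /harmonic /= invf_le1 ?ltr0n// ler1n.
by rewrite /bump_center; lra.
Qed.

Lemma cos_sumfree_point (R : realType) (k : nat) :
  cos (pi *+ 2 * sumfree_point R k) = bump_center R k.
Proof.
have /andP[c0 c1] := bump_center_itv R k.
have p2 : pi *+ 2 != 0 :> R by rewrite mulrn_eq0 /= gt_eqF// pi_gt0.
rewrite /sumfree_point mulrC divfK//.
by rewrite acosK// in_itv /=; lra.
Qed.

Lemma sumfree_point_eq0 (R : realType) (D j k : nat) :
  j != k -> sumfree D j (sumfree_point R k) = 0.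
Proof. by move=> jk; rewrite /sumfree cos_sumfree_point bump_center_eq0 ?mul0r. Qed.

(** The point lies in [0, 1/2), so for [1 < D] the angle in the sine factor is strictly between 0
    and [pi]. *)
Lemma sumfree_point_neq0 (R : realType) (D k : nat) :
  (1 < D)%N -> sumfree D k (sumfree_point R k) != 0.
Proof.
move=> D1; rewrite /sumfree cos_sumfree_point mulf_neq0 ?bump_center_neq0//.
have /andP[c0 c1] := bump_center_itv R k.
have a0 : 0 <= acos (bump_center R k) by rewrite acos_ge0//; lra.
have api : acos (bump_center R k) < pi by rewrite acos_ltpi//; lra.
have p0 := @pi_gt0 R.
have s0 : 0 <= sumfree_point R k by rewrite divr_ge0// mulrn_wge0 ?ltW.
have s1 : 2 * sumfree_point R k < 1.
  rewrite /sumfree_point -[pi *+ 2]mulr_natr; set a := acos _.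
  have pi0 : pi != 0 :> R by rewrite gt_eqF.
  have -> : 2 * (a / (pi * 2)) = a / pi.
    by clearbody a; move: (pi : R) pi0 => q q0; field.
  by rewrite ltr_pdivrMr// mul1r.
have D2 : 2 <= D%:R :> R by rewrite ler_nat.
rewrite gt_eqF// sin_gt0_pi// divr_gt0 ?ltr0n ?(ltn_trans _ D1)//=; last first.
  by rewrite mulr_gt0//; lra.
rewrite ltr_pdivrMr ?ltr0n ?(ltn_trans _ D1)// ltr_pM2l//; lra.
Qed.

(** * Lifts of an expanding map: inverse, fibers, change of variables *)

Section Lift.
Context {R : realType} {Phi : circle R -> circle R} {F : R -> R} {d : int}.
Hypothesis dF : forall t : R, is_derive t 1 F (circle_deriv Phi (circle_pi t)).
Hypothesis Phi'_gt1 : forall x, 1 < `|circle_deriv Phi x|.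
Hypothesis FP : forall t, Phi (circle_pi t) = circle_pi (F t).
Hypothesis Fd : forall t, F (t + 1) = F t + d%:~R.

Lemma lift_continuous : continuous F.
Proof.
by move=> t; apply/differentiable_continuous/derivable1_diffP; have [] := dF t.
Qed.

Lemma lift_addz (t : R) (n : int) : F (t + n%:~R) = F t + (n * d)%:~R.
Proof.
have pos (u : R) (k : nat) : F (u + k%:R) = F u + (k%:Z * d)%:~R.
  elim: k => [|k IH]; first by rewrite mul0r !addr0.
  by rewrite -natr1 addrA Fd IH -addrA -intrD; congr (_ + _%:~R); lia.
case: n => k; first exact: pos.
rewrite NegzE; have := pos (t - k.+1%:R) k.+1.
by rewrite subrK mulrNz => ->; rewrite -addrA -intrD mulNr subrr addr0.
Qed.

Lemma lift_MVT (s t : R) :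
  exists c, F t - F s = circle_deriv Phi (circle_pi c) * (t - s).
Proof.
have MVTF (a b : R) : a <= b ->
    exists c, F b - F a = circle_deriv Phi (circle_pi c) * (b - a).
  move=> ab; have [] := @MVT_segment _ F (circle_deriv Phi \o circle_pi) _ _ ab.
  - by apply: continuous_subspaceT; exact: lift_continuous.
  - by move=> c _ ->; exists c.
have [/MVTF//|/ltW/MVTF[c e]] := leP s t.
by exists c; rewrite -opprB e -mulrN opprB.
Qed.

Lemma lift_expand (s t : R) : `|s - t| <= `|F s - F t|.
Proof.
have [c ->] := lift_MVT t s.
by rewrite normrM ler_peMl// ltW.
Qed.

Lemma lift_inj : injective F.
Proof.
move=> s t st; apply/eqP; rewrite -subr_eq0 -normr_le0.
by rewrite (le_trans (lift_expand s t))// st subrr normr0.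
Qed.

Lemma lift_degree : exists x, `|d|%N%:R = `|circle_deriv Phi x|.
Proof.
have [c] := lift_MVT 0 1.
rewrite subr0 mulr1 -{1}(add0r 1) Fd addrAC subrr add0r => e.
by exists (circle_pi c); rewrite -e natr_absz intr_norm.
Qed.

Lemma lift_degree_gt1 : (1 < `|d|)%N.
Proof. by have [x dx] := lift_degree; rewrite -(ltr1n R) dx. Qed.

(** As [|d|] is at least 1, the values at [N] and [- N] lie on opposite sides of [F 0], at distance
    at least [N], and so enclose [s]. The sign of [d] decides which is lower. *)
Lemma lift_surj (s : R) : exists t, F t = s.
Proof.
pose N : nat := Num.bound `|s - F 0|.
have sN : `|s - F 0| <= N%:R.
  by apply/ltW; rewrite /N archi_boundP.
have FN : F N%:R = F 0 + (N%:Z * d)%:~R by rewrite -lift_addz add0r.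
have FNN : F (- N%:R) = F 0 - (N%:Z * d)%:~R.
  by rewrite -mulrNz -mulNr -lift_addz add0r mulrNz.
have Nd : N%:R <= `|(N%:Z * d)%:~R| :> R.
  rewrite -intr_norm normrM -[leLHS]/(N%:Z%:~R) ler_int ler_peMr//.
  by have := lift_degree_gt1; lia.
have NN : - N%:R <= N%:R :> R by rewrite ge0_cp // ler0n.
have [|c _ <-] := IVT (v := s) NN (continuous_subspaceT lift_continuous);
  last by exists c.
rewrite FN FNN ge_min le_max; move: sN Nd; rewrite ler_norml => /andP[].
set z : R := _%:~R; have [z0|z0] := leP 0 z; rewrite ?(ger0_norm z0) ?(ltr0_norm z0).
  by move=> ? ? ?; apply/andP; split; apply/orP; [left|right]; lra.
by move=> ? ? ?; apply/andP; split; apply/orP; [right|left]; lra.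
Qed.

(** [F] does not shrink distances, so its inverse is 1-Lipschitz. *)
Lemma lift_inverse :
  exists G : R -> R, [/\ cancel F G, cancel G F & continuous G].
Proof.
have [G GK] := choice lift_surj.
exists G; split => //; first by move=> t; apply: lift_inj; rewrite GK.
move=> s; apply/cvgrPdist_le => e e0; near=> t.
rewrite (le_trans (lift_expand _ _))// !GK.
by near: t; apply: cvgr_dist_le.
Unshelve. all: end_near. Qed.

Context {G : R -> R}.
Hypothesis FK : cancel F G.
Hypothesis GK : cancel G F.

(** Shifting [t] by an integer moves [F t] by a multiple of [d], so [G (s + m)] and [G (s + n)] give
    the same point of the circle exactly when [m] and [n] agree modulo [d]. *)
Lemma fsbig_fiber (v : circle R -> R) (s : R) :
  \sum_(y \in Phi @^-1` [set circle_pi s]) v y =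
  \sum_(j < `|d|) v (circle_pi (G (s + j%:R))).
Proof.
rewrite (fsbig_ord _ _ (fun j => v (circle_pi (G (s + j%:R))))).
apply: reindex_fsbig; split.
- move=> j _ /=; rewrite FP GK; exact: circle_piDn.
- move=> /= i j; rewrite !inE /= => iD jD /circle_piP/intrP[k /eqP].
  rewrite subr_eq [k%:~R + _]addrC => /eqP/(congr1 F).
  rewrite lift_addz !GK -addrA => /addrI.
  rewrite -[i%:R]/(i%:Z%:~R) -[j%:R]/(j%:Z%:~R) -intrD => /intr_inj e.
  have {}e : k * d = i%:Z - j%:Z by lia.
  have : (`|k| * `|d| < 1 * `|d|)%N by rewrite -abszM e; lia.
  rewrite ltn_mul2r ltnS leqn0 absz_eq0 => /andP[_ /eqP k0].
  by move: e; rewrite k0 mul0r; lia.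
move=> y /=; have [t _ <-] := circle_pi_unit y; rewrite FP => /circle_piP/intrP[n Fts].
have d0 : d != 0 by have := lift_degree_gt1; lia.
(* The remainder of [n] is the index sought; the quotient is absorbed by an integer shift of [t]. *)
have := divz_eq n d; have := modz_ge0 n d0; have := ltz_mod n d0.
case: (n %% d)%Z => // j jd _ nE.
exists j => /=; first by rewrite -ltz_nat abszE.
apply/circle_piP; rewrite (_ : s + j%:R = F (t - (n %/ d)%Z%:~R)).
  by rewrite FK addrAC subrr sub0r rpredN intr_int.
rewrite -mulrNz lift_addz; move/eqP: Fts; rewrite subr_eq => /eqP ->.
rewrite {1}nE mulNr mulrNz intrD /=; lra.
Qed.

Lemma circle_map_continuous : continuous Phi.
Proof.
apply/continuous_circle => t; rewrite (_ : _ \o _ = circle_pi \o F).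
  by apply: continuous_comp; [exact: lift_continuous|exact: circle_pi_continuous].
by apply/funext => s; exact: FP.
Qed.

(* The last two clauses make the functions [u k] linearly independent. *)
Lemma transfer_kernel_series :
  exists (u w : nat -> circle R -> R) (p : nat -> circle R),
    [/\ forall k, continuous (w k),
        forall k x, w k x = u k x + `|d|%:R^-1 * w k (Phi x),
        forall k s, \sum_(j < `|d|) u k (circle_pi (G (s + j%:R))) = 0,
        forall k, u k (p k) != 0 &
        forall j k, j != k -> u j (p k) = 0].
Proof.
have d1 := lift_degree_gt1; have d0 : (0 < `|d|)%N by exact: ltn_trans d1.
pose h k := sumfree `|d| k : R -> R.
(* The period [|d|] of [h k] matches the increment of [F], so [h k \o F] descends to the circle. *)
have hF1 k t : h k (F (t + 1)) = h k (F t).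
  rewrite Fd; have [dge0|dlt0] := leP 0 d.
    by have := sumfree_periodic k (F t) d0; rewrite natr_absz ger0_norm.
  have := sumfree_periodic k (F t + d%:~R) d0.
  by rewrite natr_absz ltr0_norm// mulrNz addrK => /esym.
pose u (k : nat) (x : circle R) := h k (F (repr x)).
have uE k (t : R) : u k (circle_pi t) = h k (F t).
  by apply: (circle_lift_periodic (g := h k \o F)) => r; exact: hF1.
have u_continuous k : continuous (u k).
  apply/continuous_circle => t; rewrite (_ : _ \o _ = h k \o F).
    by apply: continuous_comp; [exact: lift_continuous|exact: sumfree_continuous].
  by apply/funext => s; exact: uE.
have /choice[w wP] k : exists w : circle R -> R,
    continuous w /\ forall x, w x = u k x + `|d|%:R^-1 * w (Phi x).
  have [M uM] := circle_bounded (u_continuous k).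
  apply: geometric_cohomological_equation uM _ _ => //.
  - exact: circle_map_continuous.
  - by rewrite invf_lt1 ?ltr0n// ltr1n.
exists u, w, (fun k => circle_pi (G (sumfree_point R k))); split.
- by move=> k; exact: (wP k).1.
- by move=> k; exact: (wP k).2.
- move=> k s; rewrite -[RHS](@sum_sumfree _ `|d| k s)//.
  by apply: eq_bigr => j _; rewrite uE GK.
- by move=> k; rewrite uE GK sumfree_point_neq0.
- by move=> j k jk; rewrite uE GK; exact: sumfree_point_eq0.
Qed.

Hypothesis Phi'_continuous : continuous (circle_deriv Phi).
Hypothesis G_continuous : continuous G.
Context {rho w : circle R -> R}.
Hypothesis rho_gt0 : forall x, 0 < rho x.
Hypothesis rho_continuous : continuous rho.
Hypothesis w_continuous : continuous w.
Hypothesis w_fixed : forall s,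
  \sum_(j < `|d|) w (circle_pi (G (s + j%:R))) = w (circle_pi s).

(* Substituting [s = F t] turns the integral into one over an interval of
   length [|d|], which is cut into [|d|] translates of a period: their sum is
   the integral of [w / rho], as [w] is equal to its sums over fibers. *)
Lemma integral_deriv_eq0 :
  \int[lambda]_y (w y / rho y) = 0 ->
  \int[lambda]_y (w y / rho y * circle_deriv Phi y * (rho y / rho (Phi y))) = 0.
Proof.
move=> wrho0.
have rho_neq0 x : rho x != 0 by rewrite gt_eqF.
have rhoV_continuous : continuous (fun x : circle R => (rho x)^-1 : R).
  by move=> x; exact: (continuousV (rho_neq0 x) (@rho_continuous x)).
have wrho_continuous : continuous (fun x : circle R => w x / rho x : R).
  by move=> x; exact: (continuousM (@w_continuous x) (@rhoV_continuous x)).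
(* The integrand is the derivative of [Q \o F], the two factors [rho y] cancelling. *)
have [Q dQ] : exists Q : R -> R, forall s : R,
    is_derive s 1 Q (w (circle_pi (G s)) / rho (circle_pi s)).
  apply: continuous_antiderivative => s; apply: cvgM.
    apply: (@continuous_comp _ _ _ G (w \o circle_pi)); first exact: G_continuous.
    by move/continuous_circle : w_continuous; exact.
  by move/continuous_circle : rhoV_continuous; exact.
have QE : \int[lambda]_y (w y / rho y * circle_deriv Phi y * (rho y / rho (Phi y))) =
    Q (F 1) - Q (F 0).
  apply: (@integral_lambda _ _ (Q \o F)) => [t|x].
    apply: is_derive_eq; rewrite FK -FP.
    by field; rewrite !rho_neq0.
  apply: (continuousM (continuousM (@wrho_continuous x) (@Phi'_continuous x))).
  apply: (continuousM (@rho_continuous x)).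
  exact: (continuous_comp (@circle_map_continuous x) (@rhoV_continuous (Phi x))).
(* By [w_fixed], [P] is an antiderivative of [w / rho]. The [+ 0] gives the summands the shape
   expected by [is_derive_translate]. *)
pose P : R -> R := \sum_(j < `|d|) (fun s => Q (s + j%:R) + 0).
have dP (s : R) : is_derive s 1 P (w (circle_pi s) / rho (circle_pi s)).
  rewrite -w_fixed mulr_suml; apply: is_derive_sum => j.
  apply: is_derive_translate.
  by have := dQ (s + j%:R); rewrite circle_piDn.
(* The increment of [P] over a period has zero derivative, and its value at 0 is the integral of
   [w / rho]. *)
have P1 s : P (s + 1) = P s.
  have dP0 (x : R) : is_derive x 1 ((fun x => P (x + 1) + 0) - P) 0.
    rewrite -(subrr (w (circle_pi x) / rho (circle_pi x))).
    apply: is_deriveB; apply: is_derive_translate.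
    by have := dP (x + 1); rewrite -[1]/(1%:R) circle_piDn.
  have := is_derive_0_is_cst s 0 dP0; rewrite !fctE !addr0 add0r.
  rewrite -(@integral_lambda _ (fun x => w x / rho x) P)// wrho0.
  by move/eqP; rewrite subr_eq0 => /eqP.
(* [Q (s + |d|) - Q s] telescopes into unit increments, whose sum is [P (s + 1) - P s]. *)
have QD s : Q (s + `|d|%:R) = Q s.
  apply/eqP; rewrite -subr_eq0 -{2}[s]addr0.
  rewrite -(telescope_sumr (fun j => Q (s + j%:R)) (leq0n `|d|)) big_mkord.
  have := P1 s; rewrite /P !fct_sumE => /eqP; rewrite -subr_eq0 -sumrB.
  congr (_ == _); apply: eq_bigr => j _.
  by rewrite !addr0 -natr1 addrA [_ + 1 + _]addrAC.
rewrite QE -{1}(add0r 1) Fd; have [d0|d0] := leP 0 d.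
  by have := QD (F 0); rewrite natr_absz ger0_norm// => ->; rewrite subrr.
have := QD (F 0 + d%:~R); rewrite natr_absz ltr0_norm// mulrNz addrK => ->.
by rewrite subrr.
Qed.

End Lift.

(** * Linear combinations and the fixed functions of [Lop] *)

Lemma continuous_lin_comb (R : realType) (T : topologicalType) (a b : R)
    (f g : T -> R) :
  continuous f -> continuous g -> continuous (fun x => a * f x + b * g x : R).
Proof.
move=> cf cg x; apply: (continuousD (continuousM (cvg_cst a) (@cf x))).
exact: (continuousM (cvg_cst b) (@cg x)).
Qed.

Lemma continuous_sum_circle (R : realType) (n : nat) (c : 'I_n -> R)
    (v : nat -> circle R -> R) :
  (forall i, continuous (v i)) ->
  continuous (fun x => \sum_(i < n) c i * v i x : R).
Proof.
move=> cv; elim: (index_enum _) => [|i r IH].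
  by under eq_fun do rewrite big_nil; exact: cst_continuous.
rewrite (_ : (fun x => _) = fun x => c i * v i x + 1 * \sum_(j <- r) c j * v j x).
  exact: continuous_lin_comb.
by apply/funext => x; rewrite big_cons mul1r.
Qed.

Lemma lin_comb_eq0 (R : idomainType) (x y : R) :
  exists a b : R, ((a != 0) || (b != 0)) /\ a * x + b * y = 0.
Proof.
have [->|y0] := eqVneq y 0; last first.
  by exists y, (- x); rewrite y0 mulNr mulrC subrr.
by exists 0, 1; rewrite oner_neq0 orbT mul0r mulr0 addr0.
Qed.

Theorem proposition5p3 (R : realType) (Phi : circle R -> circle R)
    (rho : circle R -> R) (mu : probability (circle R) R)
    (Phi_expanding : expanding Phi)
    (rho_C1 : circle_fun_C 1 rho)
    (rho_gt0 : forall x, 0 < rho x)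
    (mu_rho : has_density mu rho)
    (mu_inv : invariant_measure Phi mu) :
  (cvgn (Rg_seq Phi rho) /\
   exists m, [/\ is_min (range (fun x => `|circle_deriv Phi x|)) m,
                 1 < m & m <= Rg Phi rho]) /\
  exists v : nat -> circle R -> R,
    [/\ forall i, continuous (v i),
        forall i, L2_0 mu (v i),
        lin_indep_ae mu v &
        forall i x, Lop Phi rho (v i) x = v i x].
Proof.
have [F [d [dF Phi'_continuous FP Fd]]] := expanding_lift Phi_expanding.
have [_ Phi'_gt1] := Phi_expanding.
have [G [FK GK G_continuous]] := lift_inverse dF Phi'_gt1 Fd.
have d1 := lift_degree_gt1 dF Phi'_gt1 Fd.
have d0 : (0 < `|d|)%N by exact: ltn_trans d1.
have dR0 : `|d|%:R != 0 :> R by rewrite pnatr_eq0 -lt0n.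
have fiber := fsbig_fiber dF Phi'_gt1 FP Fd FK GK.
have rho_neq0 x : rho x != 0 by rewrite gt_eqF.
have rho_continuous : continuous rho.
  apply/continuous_circle => t; apply/differentiable_continuous/derivable1_diffP.
  exact: (rho_C1.1 0%N).
have Rg_cvg : Rg_seq Phi rho n @[n --> \oo] --> (`|d|%:R : R).
  apply: Rg_seq_cvg => // x; exists (fun j => circle_pi (G (repr x + j%:R))) => v.
  by rewrite -{1}[x]circle_piK fiber.
split.
  split; first exact: (cvgP _ Rg_cvg).
  have [|x0 x0_min] := @circle_EVT_min _ (fun x => `|circle_deriv Phi x|).
    by move=> x; exact: (cvg_norm (Phi'_continuous x)).
  exists `|circle_deriv Phi x0|; split => //.
    by split; [exists x0|move=> _ [x _ <-]].
  rewrite /Rg (cvg_lim _ Rg_cvg)//.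
  by have [x ->] := lift_degree dF Fd.
have [u [w [p [w_continuous w_eq u_fiber up_neq0 up_eq0]]]] :=
  transfer_kernel_series dF Phi'_gt1 FP Fd GK.
pose I k := \int[lambda]_x (w k x / rho x).
(* Using disjoint pairs of indices to cancel the means preserves independence. *)
have /choice[a /choice[b ab]] i : exists a b : R,
    ((a != 0) || (b != 0)) /\ a * I i.*2 + b * I i.*2.+1 = 0.
  exact: lin_comb_eq0.
pose W i x := a i * w i.*2 x + b i * w i.*2.+1 x.
pose U i x := a i * u i.*2 x + b i * u i.*2.+1 x.
have WE i x : W i x = U i x + `|d|%:R^-1 * W i (Phi x).
  by rewrite /W /U !(w_eq _ x); ring.
(* [U i] sums to 0 over a fiber, while [W i \o Phi] is constant there: its [|d|] copies cancel the
   factor [|d|^-1]. *)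
have W_fiber i s : \sum_(j < `|d|) W i (circle_pi (G (s + j%:R))) = W i (circle_pi s).
  under eq_bigr do rewrite WE FP GK circle_piDn.
  rewrite big_split /= sumr_const card_ord -[_ *+ _]mulr_natl mulVKf//.
  by rewrite /U big_split /= -!mulr_sumr !u_fiber !mulr0 !add0r.
have rhoV_continuous : continuous (fun x : circle R => (rho x)^-1 : R).
  by move=> x; exact: (continuousV (rho_neq0 x) (@rho_continuous x)).
have wrho_continuous k : continuous (fun x : circle R => w k x / rho x : R).
  by move=> x; exact: (continuousM (@w_continuous k x) (@rhoV_continuous x)).
have W_continuous i : continuous (W i) by exact: continuous_lin_comb.
pose v i x := W i x / rho x.
have v_continuous i : continuous (v i).
  by move=> x; exact: (continuousM (@W_continuous i x) (@rhoV_continuous x)).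
have v0 i : \int[lambda]_x v i x = 0.
  have lambda_int (c : R) k :
      lambda.-integrable setT (EFin \o (fun x => c * (w k x / rho x))).
    apply: continuous_circle_integrable => x.
    exact: (continuousM (cvg_cst c) (@wrho_continuous k x)).
  rewrite -(ab i).2 /I -!RintegralZl//; last 2 first.
  - exact: continuous_circle_integrable.
  - exact: continuous_circle_integrable.
  rewrite -RintegralD//.
  by apply: eq_Rintegral => x _; rewrite /v /W; ring.
exists v; split => //.
- by move=> i; split; [exact: continuous_circle_Lfun2|exact: v0].
- move=> n c cv0.
  (* Continuity turns almost everywhere into everywhere, which permits evaluation at the points
     [p k]. *)
  have {}cv0 x : \sum_(i < n) c i * v i x = 0.
    move: x; apply: continuous_ae_eq0 mu_rho rho_continuous rho_gt0 _ cv0.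
    exact: continuous_sum_circle.
  have cW0 x : \sum_(i < n) c i * W i x = 0.
    transitivity ((\sum_(i < n) c i * v i x) * rho x); last by rewrite cv0 mul0r.
    rewrite mulr_suml; apply: eq_bigr => i _.
    by rewrite /v mulrA divfK.
  have cU0 x : \sum_(i < n) c i * U i x = 0.
    transitivity (\sum_(i < n) c i * W i x -
                  `|d|%:R^-1 * \sum_(i < n) c i * W i (Phi x)); last first.
      by rewrite !cW0 mulr0 subr0.
    rewrite mulr_sumr -sumrB; apply: eq_bigr => i _.
    by rewrite (WE i x); ring.
  (* At [p k] only the pair containing [k] survives. Whichever of [a i] and [b i] is nonzero then
     selects [k] as [i.*2] or [i.*2.+1]. *)
  move=> i; have cUp (k : nat) : k./2 = i -> c i * U i (p k) = 0.
    move=> ki; have := cU0 (p k); rewrite (bigD1 i)//= big1 ?addr0// => j ji.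
    have jk : j.*2 != k by apply: contraNneq ji => e; apply/eqP/val_inj => /=; lia.
    have jk1 : j.*2.+1 != k by apply: contraNneq ji => e; apply/eqP/val_inj => /=; lia.
    by rewrite /U !up_eq0// !mulr0 addr0 mulr0.
  have ne : i.*2.+1 != i.*2 by lia.
  have ne' : i.*2 != i.*2.+1 by lia.
  have [/orP[a0|b0] _] := ab i; apply/eqP.
    have /eqP := cUp i.*2 (doubleK i).
    rewrite /U (up_eq0 _ _ ne) mulr0 addr0 !mulf_eq0.
    by rewrite (negbTE a0) (negbTE (up_neq0 _)) !orbF.
  have /eqP := cUp i.*2.+1 (uphalf_double i).
  rewrite /U (up_eq0 _ _ ne') mulr0 add0r !mulf_eq0.
  by rewrite (negbTE b0) (negbTE (up_neq0 _)) !orbF.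
- move=> i x.
  have v0' : \int[lambda]_y (W i y / rho y) = 0 by exact: v0.
  rewrite /Lop (integral_deriv_eq0 dF FP Fd FK Phi'_continuous G_continuous
    rho_gt0 rho_continuous (W_continuous i) (W_fiber i) v0') mul0r subr0.
  (* The weight cancels the denominator of [v i], leaving the sum of [W i] over the fiber. *)
  rewrite /Ltilde -[x]circle_piK fiber /v -[in RHS]W_fiber mulr_suml.
  by apply: eq_bigr => j _; field; rewrite !rho_neq0.
Qed.
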